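(* Fix integers $r, m \geq 1$, and let $\ell\ge r+5$ be a prime such that $r_\ell(r) \leq 1$. If $b_1, b_2 \geq b_\ell(r,m)$ and $b_1 \equiv b_2 \pmod{2}$, then there is an integer $C_\ell(r, b_1, b_2, m)$ such that for all $n$ we have $$p_r\!\left(\frac{\ell^{b_1}n + r}{24}\right) \equiv C_\ell(r,b_1, b_2, m)\cdot p_r\!\left(\frac{\ell^{b_2}n + r}{24}\right) \pmod{\ell^m}.$$ If $r_\ell(r) = 0$, then $C_\ell(r, b_1, b_2, m)= 0$.
   Context: Throughout $q=e^{2\pi i z}$ and $\eta(z)=q^{1/24}\prod_{n\ge1}(1-q^n)$. The function $p_r$ is defined by $\prod_{n\ge 1}(1-q^n)^{-r}=\sum_{n\ge 0}p_r(n)q^n$, with $p_r(x)=0$ if $x$ is not a non-negative integer. For $b\ge 0$ set $$P_\ell(r,b;z)=\sum_{n\in\mathbb{Z}} p_r\!\left(\frac{\ell^b n+r}{24}\right)q^{n/24}.$$ For integers $b\ge 0$, $m\ge 1$ define $$\Lambda_\ell^{\mathrm{odd}}(r,b,m)=\mathrm{Span}_{\mathbb{Z}/\ell^m\mathbb{Z}}\{\eta(\ell z)^rP_\ell(r,\beta;z)\bmod \ell^m : \beta\ge b,\ \beta\text{ odd}\},$$ $$\Lambda_\ell^{\mathrm{even}}(r,b,m)=\mathrm{Span}_{\mathbb{Z}/\ell^m\mathbb{Z}}\{\eta(z)^rP_\ell(r,\beta;z)\bmod \ell^m : \beta\ge b,\ \beta\text{ even}\}$$ (submodules of $(\mathbb{Z}/\ell^m\mathbb{Z})[[q]]$).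 For $\ell\ge r+5$ prime these decreasing sequences stabilize; $b_\ell(r,m)$ is the least integer $B\ge 0$ such that $\Lambda_\ell^{\mathrm{odd}}(r,2b+1,m)$ is constant for all $b\ge0$ with $2b+1\ge B$ and $\Lambda_\ell^{\mathrm{even}}(r,2b,m)$ is constant for all $b\ge0$ with $2b\ge B$. The stable value of $\Lambda_\ell^{\mathrm{odd}}(r,2b+1,m)$ is $\Omega_\ell^{\mathrm{odd}}(r,m)$, and $r_\ell(r)$ denotes its rank as a $\mathbb{Z}/\ell^m\mathbb{Z}$-module (minimal number of generators). *)

(* Defs.v *)
From HB Require Import structures.
From mathcomp Require Import all_boot all_order all_algebra.
From mathcomp Require Import boolp classical_sets functions fsbigop.

Set Implicit Arguments.
Unset Strict Implicit.
Unset Printing Implicit Defensive.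

Import Order.TTheory GRing.Theory Num.Theory.

Local Open Scope classical_set_scope.
Local Open Scope ring_scope.

(* Coefficient of q^n in \prod_(k >= 1) (1 - q^k)^r; the factors with k > n
   do not contribute to it. *)
Definition euler_prod (n : nat) : {poly int} :=
  \prod_(1 <= k < n.+1) (1 - 'X^k).
Definition euler_coef (r n : nat) : int := (euler_prod n ^+ r)`_n.

(* Coefficient of q^n in \prod_(k >= 1) (1 - q^k)^(-r), where
   (1 - q^k)^(-1) = \sum_j q^(kj); the terms with k > n or j > n do not
   contribute to it.  See [part_coefM] below. *)
Definition part_prod (n : nat) : {poly int} :=
  \prod_(1 <= k < n.+1) \sum_(j < n.+1) 'X^(k * j).
Definition part_coef (r n : nat) : int := (part_prod n ^+ r)`_n.

Lemma part_coefM (r n : nat) :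
  \sum_(i < n.+1) part_coef r i * euler_coef r (n - i) = (n == 0%N)%:R.
Proof.
pose eqX N (p q : {poly int}) := forall i, (i <= N)%N -> p`_i = q`_i.
have eqXM N p p' q q' : eqX N p p' -> eqX N q q' -> eqX N (p * q) (p' * q').
  move=> pp' qq' i iN; rewrite !coefM; apply: eq_bigr => j _.
  by rewrite pp' ?qq' // (leq_trans _ iN) ?leq_subr // -ltnS.
have eqXX N p p' k : eqX N p p' -> eqX N (p ^+ k) (p' ^+ k).
  by move=> pp'; elim: k => [|k IH]; rewrite ?expr0 // !exprS; apply: eqXM.
have eqXprod N (s : seq nat) (F G : nat -> {poly int}) :
    (forall k, k \in s -> eqX N (F k) (G k)) ->
    eqX N (\prod_(k <- s) F k) (\prod_(k <- s) G k).
  elim: s => [|k s IH] FG; first by rewrite !big_nil.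
  rewrite !big_cons; apply: eqXM; first by apply: FG; rewrite inE eqxx.
  by apply: IH => j js; apply: FG; rewrite inE js orbT.
have eqXtrans N p q t : eqX N p q -> eqX N q t -> eqX N p t.
  by move=> pq qt i iN; rewrite pq // qt.
have tail N M (F : nat -> {poly int}) : (N <= M)%N ->
    (forall k, (N < k)%N -> eqX N (F k) 1) ->
    eqX N (\prod_(1 <= k < N.+1) F k) (\prod_(1 <= k < M.+1) F k).
  move=> NM F1; rewrite [in X in eqX _ _ X](@big_cat_nat _ _ _ N.+1) //=.
  rewrite -[X in eqX _ X _]mulr1; apply: eqXM => //.
  have /= := eqXprod N (index_iota N.+1 M.+1) (fun=> 1) F.
  rewrite big1_eq; apply=> k; rewrite mem_index_iota => /andP[Nk _] i iN.
  by rewrite F1.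
have eulerS N M : (N <= M)%N -> eqX N (euler_prod N) (euler_prod M).
  move=> NM; apply: tail => // k Nk i iN; rewrite coefB coefXn.
  by rewrite ltn_eqF ?subr0 // (leq_ltn_trans iN).
have geomS N M M' k : (0 < k)%N -> (N <= M)%N -> (M <= M')%N ->
    eqX N (\sum_(j < M.+1) 'X^(k * j)) (\sum_(j < M'.+1) 'X^(k * j)).
  move=> k0 NM MM' i iN.
  rewrite -!(big_mkord xpredT (fun j => 'X^(k * j) : {poly int})).
  rewrite [in RHS](@big_cat_nat _ _ _ M.+1) //= coefD.
  rewrite [X in _ + X]coef_sum [X in _ + X]big1_seq ?addr0 // => j.
  rewrite mem_index_iota => /andP[_ /andP[Mj _]]; rewrite coefXn ltn_eqF //.
  apply: (leq_ltn_trans iN); apply: (leq_ltn_trans NM).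
  by apply: (leq_trans Mj); rewrite leq_pmull.
have partS N M : (N <= M)%N -> eqX N (part_prod N) (part_prod M).
  move=> NM; apply: (eqXtrans _ _
    (\prod_(1 <= k < N.+1) \sum_(j < M.+1) 'X^(k * j))).
    apply: eqXprod => k; rewrite mem_index_iota => /andP[k0 _].
    exact: geomS.
  apply: tail => // k Nk i iN; rewrite big_ord_recl muln0 expr0 coefD.
  rewrite coef_sum big1 ?addr0 // => j _; rewrite coefXn ltn_eqF //.
  by apply: (leq_ltn_trans iN); apply: (leq_trans Nk); rewrite leq_pmulr.
transitivity ((part_prod n ^+ r * euler_prod n ^+ r)`_n).
  rewrite coefM; apply: eq_bigr => i _; congr (_ * _).
    by apply: (eqXX i) => //; apply: partS; rewrite -ltnS.
  by apply: (eqXX (n - i)%N) => //; apply: eulerS; rewrite leq_subr.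
rewrite -exprMn -big_split /= -[RHS]coef1; apply: (eqXtrans n _ (1 ^+ r)) => //.
  apply: eqXX; have /= := eqXprod n (index_iota 1 n.+1)
    (fun k => (\sum_(j < n.+1) 'X^(k * j)) * (1 - 'X^k)) (fun=> 1).
  rewrite big1_eq; apply=> k; rewrite mem_index_iota => /andP[k0 _] i iN.
  have -> : (\sum_(j < n.+1) 'X^(k * j)) * (1 - 'X^k)
      = 1 - 'X^(k * n.+1) :> {poly int}.
    rewrite exprM -[in RHS](expr1n _ n.+1) subrXX mulrC; congr (_ * _).
    by apply: eq_bigr => j _; rewrite expr1n mul1r exprM.
  rewrite coefB coefXn ltn_eqF ?subr0 //.
  by rewrite (leq_ltn_trans iN) // leq_pmull.
by rewrite expr1n.
Qed.

Definition ext_rat (a : nat -> int) (x : rat) : int :=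
  if x \is a Num.nat then a (Num.truncn x) else 0.

Definition p_ (r : nat) (x : rat) : int := ext_rat (part_coef r) x.

(* The argument (l^b n + r) / 24 of p_r. *)
Definition p_arg (l r b : nat) (n : int) : rat :=
  ((l ^ b)%N%:R * n%:~R + r%:R) / 24%:R.

(* A formal Laurent series in q^(1/24) is represented by the function f on int
   such that f e is the coefficient of q^(e/24). *)

(* eta(d z)^r = q^(dr/24) \prod_(k >= 1) (1 - q^(dk))^r. *)
Definition eta_pow (d r : nat) (e : int) : int :=
  ext_rat (euler_coef r) ((e%:~R - (d * r)%N%:R) / (24 * d)%N%:R).

Definition P_series (l r b : nat) (n : int) : int := p_ r (p_arg l r b n).

(* This sum is finitely supported when the supports of f and g are bounded below,
   which is the case of all the series multiplied here. *)
Definition laurent_mul (f g : int -> int) (e : int) : int :=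
  \sum_(i \in [set: int]) f i * g (e - i).

Definition series_mod (N : nat) (f : int -> int) : int -> ('Z_N)^o :=
  fun e => (f e)%:~R.

Definition span (R : pzRingType) (V : lmodType R) (S : set V) : set V :=
  [set v | exists (n : nat) (c : 'I_n -> R) (g : 'I_n -> V),
     (forall i, S (g i)) /\ v = \sum_(i < n) c i *: g i].

(* M has rank d: d is the minimal number of generators of M. *)
Definition generated_by (R : pzRingType) (V : lmodType R) (M : set V)
    (d : nat) : Prop :=
  exists g : 'I_d -> V, M = span (range g).
Definition has_rank (R : pzRingType) (V : lmodType R) (M : set V)
    (d : nat) : Prop :=
  generated_by M d /\ forall d', generated_by M d' -> (d <= d')%N.

(* For a prime l >= 5 the generators only involve exponents e in 24 * nat, so
   that these are submodules of (Z/l^m)[[q]], seen inside the Laurent series in q^(1/24). *)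
Definition Lambda_odd (l r b m : nat) : set (int -> ('Z_(l ^ m))^o) :=
  span [set f | exists beta : nat, [/\ (b <= beta)%N, odd beta &
    f = series_mod (l ^ m) (laurent_mul (eta_pow l r) (P_series l r beta))]].

Definition Lambda_even (l r b m : nat) : set (int -> ('Z_(l ^ m))^o) :=
  span [set f | exists beta : nat, [/\ (b <= beta)%N, ~~ odd beta &
    f = series_mod (l ^ m) (laurent_mul (eta_pow 1 r) (P_series l r beta))]].

Arguments Lambda_odd : clear implicits.
Arguments Lambda_even : clear implicits.

Definition Lambda_constant_from (l r m B : nat) : Prop :=
  (forall b b' : nat, (B <= 2 * b + 1)%N -> (B <= 2 * b' + 1)%N ->
     Lambda_odd l r (2 * b + 1)%N m = Lambda_odd l r (2 * b' + 1)%N m) /\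
  (forall b b' : nat, (B <= 2 * b)%N -> (B <= 2 * b')%N ->
     Lambda_even l r (2 * b)%N m = Lambda_even l r (2 * b')%N m).

(* B = b_l(r, m).  This is a relation because the least B is only defined when
   the two sequences stabilize. *)
Definition is_b_l (l r m B : nat) : Prop :=
  Lambda_constant_from l r m B /\
  forall B', Lambda_constant_from l r m B' -> (B <= B')%N.

(* Om = Omega_l^odd(r, m). *)
Definition is_Omega_odd (l r m : nat) (Om : set (int -> ('Z_(l ^ m))^o)) : Prop :=
  exists b0 : nat, forall b, (b0 <= b)%N -> Lambda_odd l r (2 * b + 1)%N m = Om.

Arguments is_Omega_odd : clear implicits.

(* rho = r_l(r), computed modulo l^m. *)
Definition is_r_l (l r m rho : nat) : Prop :=
  exists Om, is_Omega_odd l r m Om /\ has_rank Om rho.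

(* Main.v *)
From HB Require Import structures.
From mathcomp Require Import all_boot all_order all_algebra zify ring.
From mathcomp Require Import boolp classical_sets functions fsbigop.

Require Import Defs.

Import Order.TTheory GRing.Theory Num.Theory.
Local Open Scope ring_scope.
Local Open Scope classical_set_scope.

Set Implicit Arguments.
Unset Strict Implicit.
Unset Printing Implicit Defensive.

(** Write x_b for P_l(r, b; z) modulo l^m. The operator keeping every l-th
    coefficient, [dilate l], sends x_b to x_(b+1), so with T its square the
    series x_b, x_(b+2), x_(b+4), ... form the T-orbit of x_b. The module
    Lambda at b is the image of the span X_b of this orbit under multiplication
    by eta(dz)^r, where d = l for odd b and d = 1 for even b. That
    multiplication is injective on series with exponents bounded below, since
    eta(dz)^r has leading coefficient 1. So equalities and bounds on the number
    of generators descend from the Lambda modules to the spans X_b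
    ([generated_by_inj], [eta_mul_inj]).

    The heart of the argument is [cyclic_orbit]: X_b is stable under T, so if
    it is generated by one element g, then T g = t g for a scalar t, hence T
    acts as t on all of X_b, hence x_(b+2k) = t^k x_b and x_b itself generates
    X_b. Now if b1 and b2 have the same parity and both lie in the stable
    range, then X_b1 = X_b2, so x_b1 lies in X_b2 and is therefore a multiple
    of x_b2; when the rank is 0, X_b2 is zero and so is x_b1.

    The rank hypothesis concerns the odd modules only. It passes to the even
    ones because [dilate l] maps X_b onto X_(b+1), and a linear image of a
    module needs no more generators than the module. *)

(** * Spans, generators and orbits *)

Section Span.
Variables (R : pzRingType) (V : lmodType R).
Implicit Types (S M : set V) (u v : V).

Lemma sub_span S : S `<=` span S.
Proof.
move=> v Sv; exists 1%N, (fun=> 1), (fun=> v); split=> //.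
by rewrite big_ord1 scale1r.
Qed.

Lemma span0 S : span S 0.
Proof.
by exists 0%N, (fun=> 0), (fun=> 0); split; [case | rewrite big_ord0].
Qed.

Lemma span_linear S a u v : span S u -> span S v -> span S (a *: u + v).
Proof.
move=> [m [c [g [Sg ->]]]] [n [d [h [Sh ->]]]].
exists (m + n)%N,
  (fun i => match fintype.split i with inl j => a * c j | inr k => d k end),
  (fun i => match fintype.split i with inl j => g j | inr k => h k end).
split=> [i|]; first by case: (fintype.split i).
rewrite big_split_ord scaler_sumr; congr (_ + _); apply: eq_bigr => i _.
  by rewrite (unsplitK (inl i)) scalerA.
by rewrite (unsplitK (inr i)).
Qed.

Lemma spanB S u v : span S u -> span S v -> span S (u - v).
Proof. by move=> Su Sv; rewrite addrC -scaleN1r; apply: span_linear. Qed.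

Lemma span_min S M : S `<=` M -> M 0 ->
  (forall a u v, M u -> M v -> M (a *: u + v)) -> span S `<=` M.
Proof.
move=> SM M0 Mlin _ [n [c [g [Sg ->]]]].
by elim/big_ind: _ => // [u v Mu Mv|i _];
  [rewrite -[u]scale1r | rewrite -[_ *: _]addr0]; apply: Mlin => //; apply: SM.
Qed.

Lemma span_sub S S' : S `<=` span S' -> span S `<=` span S'.
Proof. by move=> SS'; apply: span_min SS' (span0 _) (@span_linear _). Qed.

Lemma generated_by0 M v : generated_by M 0 -> M v -> v = 0.
Proof.
case=> g ->; apply: (@span_min _ [set 0]) => [_ [[]]||a _ _ -> ->] //.
by rewrite scaler0 addr0.
Qed.

Lemma generated_by_le1 M d : generated_by M d -> (d <= 1)%N ->
  exists2 g, M g & forall v, M v -> exists c, v = c *: g.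
Proof.
move=> Md; case: d Md => [Md _|[[g ->] _|//]].
  have M0 : M 0 by case: Md => g ->; exact: span0.
  by exists 0 => // v /(generated_by0 Md) ->; exists 0; rewrite scaler0.
exists (g ord0); first by apply: sub_span; exists ord0.
apply: span_min => [_ [i _ <-]||a _ _ [c ->] [d ->]].
- by exists 1; rewrite (ord1 i) scale1r.
- by exists 0; rewrite scale0r.
- by exists (a * c + d); rewrite scalerDl scalerA.
Qed.

End Span.

Section SpanImage.
Variables (R : pzRingType) (V W : lmodType R) (f : {linear V -> W}).
Implicit Types (S M : set V).

Lemma span_image S : span (f @` S) = f @` span S.
Proof.
apply/seteqP; split.
  apply: span_min => [_ [v Sv <-]||a _ _ [u Su <-] [v Sv <-]].
  - by exists v => //; apply: sub_span.
  - by exists 0; [exact: span0 | rewrite linear0].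
  - by exists (a *: u + v); [exact: span_linear | rewrite linearP].
move=> _ [_ [n [c [g [Sg ->]]]] <-].
exists n, c, (f \o g); split=> [i|]; first by exists (g i).
by rewrite linear_sum; apply: eq_bigr => i _; rewrite linearZ.
Qed.

Lemma generated_by_image M d : generated_by M d -> generated_by (f @` M) d.
Proof. by case=> g ->; exists (f \o g); rewrite -span_image image_comp. Qed.

(** Generators of the image of the span lift to elements of the span, and
    injectivity makes the lifts generate. Injectivity is only asked on the span,
    since that of [eta_mul] below rests on a lower bound for the exponents. *)
Lemma generated_by_inj S d : (forall v, span S v -> f v = 0 -> v = 0) ->
  generated_by (span (f @` S)) d -> generated_by (span S) d.
Proof.
move=> f_inj [g]; rewrite span_image => fSg.
have /choice[h hP] i : exists v, span S v /\ f v = g i.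
  have [v Sv fv] : (f @` span S) (g i) by rewrite fSg; apply: sub_span; exists i.
  by exists v.
exists h; have hS : span (range h) `<=` span S.
  by apply: span_sub => _ [i _ <-]; case: (hP i).
apply/seteqP; split=> // v Sv.
have : (f @` span S) (f v) by exists v.
have -> : f @` span S = f @` span (range h).
  rewrite fSg -span_image image_comp; congr (span (_ @` _)).
  by apply/funext => i /=; case: (hP i).
case=> w hw fwv; suff /subr0_eq -> : v - w = 0 by [].
by apply: f_inj; [apply: spanB => //; exact: hS | rewrite linearB /= fwv subrr].
Qed.

End SpanImage.

Definition orbit (V : Type) (T : V -> V) (x : V) : set V :=
  range (fun k => iter k T x).

Lemma orbit_image (V W : Type) (T : V -> V) (U : W -> W) (f : V -> W) x :
  (forall y, f (T y) = U (f y)) -> f @` orbit T x = orbit U (f x).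
Proof.
move=> fTU; rewrite /orbit image_comp; congr (_ @` _); apply/funext => k /=.
by elim: k => [//|k IH] /=; rewrite fTU IH.
Qed.

(** The span is stable under T, so T maps its generator g to a multiple of g by
    some t and thus acts on the whole span as the scalar t. All iterates of x are
    then multiples of x. *)
Lemma cyclic_orbit (R : comNzRingType) (V : lmodType R) (T : {linear V -> V})
    (x : V) (d : nat) : generated_by (span (orbit T x)) d -> (d <= 1)%N ->
  forall v, span (orbit T x) v -> exists c, v = c *: x.
Proof.
move=> Xd /(generated_by_le1 Xd)[g Xg gX].
have [t Tg] : exists t, T g = t *: g.
  apply: gX; move: g Xg.
  apply: span_min => [_ [k _ <-]||a u v Xu Xv].
  - by apply: sub_span; exists k.+1.
  - by rewrite linear0; exact: span0.
  - by rewrite linearP; exact: span_linear.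
have xX : span (orbit T x) x by apply: sub_span; exists 0%N.
have iterT k : iter k T x = t ^+ k *: x.
  elim: k => [|k /= ->]; first by rewrite expr0 scale1r.
  have [c ->] := gX _ xX.
  by rewrite !linearZ /= Tg !scalerA exprSr; congr (_ *: _); ring.
apply: span_min => [_ [k _ <-]||a _ _ [b ->] [c ->]].
- by exists (t ^+ k); rewrite iterT.
- by exists 0; rewrite scale0r.
- by exists (a * b + c); rewrite scalerDl scalerA.
Qed.

(** * Series in the 24th root of q *)

Definition vanishes_below (R : nmodType) (a : int) (h : int -> R) :=
  forall n, n < a -> h n = 0.

(** On q-expansions this is the operator U_s, which sends the sum of
    h(n) q^(n/24) to the sum of h(sn) q^(n/24). *)
Definition dilate (R : pzRingType) (s : nat) (h : int -> R^o) : int -> R^o :=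
  fun n => h (s%:Z * n).

Lemma dilate_linear R s : linear (@dilate R s).
Proof. by []. Qed.
HB.instance Definition _ R s :=
  GRing.isLinear.Build R (int -> R^o) (int -> R^o) _ (dilate s)
    (@dilate_linear R s).

(** Multiplication by eta(dz)^r. Cutting the sum at k = |e| loses nothing for a
    series h that vanishes below -r, and makes the operator linear on the space
    of all functions. *)
Definition eta_mul (R : pzRingType) (d r : nat) (h : int -> R^o) :
    int -> R^o :=
  fun e => \sum_(k < `|e|%N.+1)
    (euler_coef r k)%:~R * h (e - (d * r)%N%:Z - (24 * d * k)%N%:Z).

Lemma eta_mul_linear (R : comPzRingType) d r : linear (@eta_mul R d r).
Proof.
move=> a u v; apply/funext => e; rewrite /eta_mul -[RHS]/(_ + _) /=.
rewrite -[(a *: _) e]/(a * _) mulr_sumr -big_split; apply: eq_bigr => k _ /=.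
rewrite -[(_ + _) _]/(a * _ + _); ring.
Qed.
HB.instance Definition _ (R : comPzRingType) d r :=
  GRing.isLinear.Build R (int -> R^o) (int -> R^o) _ (eta_mul d r)
    (@eta_mul_linear R d r).

Lemma euler_coef0 r : euler_coef r 0 = 1.
Proof. by rewrite /euler_coef /euler_prod big_geq // expr1n coef1. Qed.

(** The coefficient of the product at i + dr is h i plus a combination of values
    of h at smaller arguments, so h vanishes by induction from its lower bound. *)
Lemma eta_mul_inj (R : pzRingType) (d r : nat) a (h : int -> R^o) :
  vanishes_below a h -> eta_mul d r h = 0 -> d != 0%N -> h = 0.
Proof.
move=> ha Eh d0; suff hN (n : nat) (i : int) : i < a + n%:Z -> h i = 0.
  by apply/funext => i; apply: (hN `|i - a|.+1); lia.
elim: n i => [|n IH] i; first by rewrite addr0; exact: ha.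
move=> ian; have := congr1 (fun u => u (i + (d * r)%N%:Z)) Eh.
rewrite /eta_mul big_ord_recl /= euler_coef0 mul1r muln0 subr0 addrK.
rewrite big1 ?addr0 // => k _; rewrite IH ?mulr0 //.
rewrite /bump /=; nia.
Qed.

Lemma ext_rat_nat a (n : nat) : ext_rat a n%:R = a n.
Proof. by rewrite /ext_rat natr_nat natrK. Qed.

Lemma ext_rat_neq0 a x : ext_rat a x != 0 -> exists n : nat, x = n%:R.
Proof.
by rewrite /ext_rat; case: natrP => [[n ->]|]; [exists n | rewrite eqxx].
Qed.

Lemma eta_powE (d r k : nat) : d != 0%N ->
  eta_pow d r ((d * r)%N%:Z + (24 * d * k)%N%:Z) = euler_coef r k.
Proof.
move=> d0; rewrite /eta_pow -(ext_rat_nat (euler_coef r)); congr ext_rat.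
have : d%:R != 0 :> rat by rewrite pnatr_eq0.
by rewrite intrD -!pmulrn !natrM => d0'; field.
Qed.

Lemma eta_pow_supp (d r : nat) i : d != 0%N -> eta_pow d r i != 0 ->
  exists k : nat, i = (d * r)%N%:Z + (24 * d * k)%N%:Z.
Proof.
move=> d0 /ext_rat_neq0[k ik]; exists k; apply: (@intr_inj rat).
have d0' : d%:R != 0 :> rat by rewrite pnatr_eq0.
by rewrite intrD -!pmulrn [(24 * d * k)%N%:R]natrM -ik; field.
Qed.

(** If n < -r then l^b n + r is negative. *)
Lemma P_series_vanishes l r b : (0 < l)%N ->
  vanishes_below (- r%:Z) (P_series l r b).
Proof.
move=> l0 n nr; apply/eqP; apply: contraT => /ext_rat_neq0[k].
rewrite /p_arg => /(canRL (divfK _)) => /(_ isT) E.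
have : (l ^ b)%N%:Z * n + r%:Z = (k * 24)%N%:Z.
  by apply: (@intr_inj rat); rewrite intrD intrM -!pmulrn natrM.
have : (0 < l ^ b)%N by rewrite expn_gt0 l0.
move: (l ^ b)%N => L; nia.
Qed.

Lemma P_seriesS l r b n : P_series l r b.+1 n = P_series l r b (l%:Z * n).
Proof.
by rewrite /P_series /p_arg expnSr natrM intrM -pmulrn mulrA.
Qed.

(** The sum over all integers defining the product reduces to the exponents
    dr + 24dk of eta(dz)^r; those with k > |e| are paired with coefficients of f
    below -r. *)
Lemma series_mod_eta_mul (N d r : nat) (f : int -> int) :
  d != 0%N -> vanishes_below (- r%:Z) f ->
  series_mod N (laurent_mul (eta_pow d r) f) = eta_mul d r (series_mod N f).
Proof.
move=> d0 f0; apply/funext => e; rewrite /series_mod /laurent_mul /eta_mul.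
pose s := [seq (d * r)%N%:Z + (24 * d * k)%N%:Z | k <- index_iota 0 `|e|.+1].
rewrite -(@fsbig_widen _ _ _ _ [set` s]) //; last first.
  move=> i [_ /= si]; apply/eqP; apply: contraNT (introN idP si).
  rewrite mulf_eq0 negb_or => /andP[/(eta_pow_supp d0)[k ->] fi].
  apply/mapP; exists k => //; rewrite mem_index_iota /= ltnS leqNgt.
  apply: contra fi => ek.
  apply/eqP/f0; nia.
rewrite -fsbig_seq; last first.
  by rewrite map_inj_in_uniq ?iota_uniq // => i j _ _; nia.
rewrite big_map big_mkord rmorph_sum; apply: eq_bigr => k _ /=.
by rewrite rmorphM /= eta_powE // opprD addrA.
Qed.

(** * The modules of the theorem as orbit spans *)

Section PSeriesMod.
Variables (N l r : nat).
Hypothesis l_gt0 : (0 < l)%N.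

Definition P_mod (b : nat) : int -> ('Z_N)^o := series_mod N (P_series l r b).

(** Two steps of U_l, so that the parity of b is kept. *)
Definition dilate2 : {linear (int -> ('Z_N)^o) -> (int -> ('Z_N)^o)} :=
  dilate l \o dilate l.

Lemma dilate_P_mod b : dilate l (P_mod b) = P_mod b.+1.
Proof. by apply/funext => n; rewrite /dilate /P_mod /series_mod P_seriesS. Qed.

Lemma iter_dilate2 k b : iter k dilate2 (P_mod b) = P_mod (b + k.*2).
Proof.
elim: k => [|k IH]; first by rewrite addn0.
by rewrite iterS IH /= !dilate_P_mod doubleS !addnS.
Qed.

Lemma eta_P_mod_orbit d b : d != 0%N ->
  [set f | exists beta : nat, [/\ (b <= beta)%N, odd beta = odd b &
    f = series_mod N (laurent_mul (eta_pow d r) (P_series l r beta))]] =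
  eta_mul d r @` orbit dilate2 (P_mod b).
Proof.
move=> d0; have PE beta :
    series_mod N (laurent_mul (eta_pow d r) (P_series l r beta)) =
    eta_mul d r (P_mod beta).
  by rewrite series_mod_eta_mul //; exact: P_series_vanishes.
apply/seteqP; split=> [_ [beta [bb parity ->]]|_ [_ [k _ <-] <-]].
  exists (P_mod beta) => //; exists (beta - b)./2 => //.
  rewrite iter_dilate2 halfK oddB // parity addbb subn0.
  by rewrite subnKC.
exists (b + k.*2)%N; rewrite leq_addr oddD odd_double addbF; split=> //.
by rewrite iter_dilate2 PE.
Qed.

Lemma span_orbit_vanishes b v :
  span (orbit dilate2 (P_mod b)) v -> vanishes_below (- r%:Z) v.
Proof.
move: v; apply: span_min => [_ [k _ <-]|//|a u v u0 v0] n nr.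
  rewrite iter_dilate2 /P_mod /series_mod.
  by rewrite (P_series_vanishes _ l_gt0 nr).
by rewrite -[LHS]/(a * u n + v n) u0 // v0 // mulr0 addr0.
Qed.

Lemma generated_by_eta_mul d b rho : d != 0%N ->
  generated_by (span (eta_mul d r @` orbit dilate2 (P_mod b))) rho ->
  generated_by (span (orbit dilate2 (P_mod b))) rho.
Proof.
move=> d0; apply: generated_by_inj => v /span_orbit_vanishes v0 Ev.
exact: eta_mul_inj v0 Ev d0.
Qed.

(** Equality of the eta multiples puts x_b1 into the span of the orbit of x_b2,
    by injectivity of the multiplication; [cyclic_orbit] then makes it a multiple
    of x_b2. *)
Lemma P_mod_proportional d b1 b2 rho : d != 0%N ->
  span (eta_mul d r @` orbit dilate2 (P_mod b1)) =
    span (eta_mul d r @` orbit dilate2 (P_mod b2)) ->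
  generated_by (span (orbit dilate2 (P_mod b2))) rho -> (rho <= 1)%N ->
  exists c, P_mod b1 = c *: P_mod b2 /\ (rho = 0%N -> c = 0).
Proof.
move=> d0 E12 rank2 rho1.
have b1_in : orbit dilate2 (P_mod b1) (P_mod b1) by exists 0%N.
have : span (eta_mul d r @` orbit dilate2 (P_mod b1)) (eta_mul d r (P_mod b1)).
  by apply: sub_span; exists (P_mod b1).
rewrite E12 span_image => -[w w_in Ew].
have {Ew} /subr0_eq E1w : P_mod b1 - w = 0.
  apply: (@eta_mul_inj _ d r (- r%:Z)) => //; last by rewrite linearB /= Ew subrr.
  move=> n nr; rewrite -[LHS]/(P_mod b1 n - w n).
  rewrite (span_orbit_vanishes w_in) //.
  by rewrite (span_orbit_vanishes (sub_span b1_in)) // subr0.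
rewrite E1w; case: rho rank2 rho1 => [|rho] rank2 rho1.
  by exists 0; rewrite scale0r (generated_by0 rank2 w_in).
by have [c ->] := cyclic_orbit rank2 rho1 w_in; exists c.
Qed.

End PSeriesMod.

Lemma Lambda_oddE l r b m : (0 < l)%N -> odd b -> Lambda_odd l r b m =
  span (eta_mul l r @` orbit (dilate2 (l ^ m) l) (P_mod (l ^ m) l r b)).
Proof.
move=> l0 b_odd; rewrite -(eta_P_mod_orbit _ _ l0) -?lt0n // /Lambda_odd.
by rewrite b_odd.
Qed.

Lemma Lambda_evenE l r b m : (0 < l)%N -> ~~ odd b -> Lambda_even l r b m =
  span (eta_mul 1 r @` orbit (dilate2 (l ^ m) l) (P_mod (l ^ m) l r b)).
Proof.
move=> l0 /negbTE b_even; rewrite -(eta_P_mod_orbit _ _ l0) // b_even.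
congr span; apply/seteqP; split=> _ [beta [bb parity ->]]; exists beta.
  by rewrite (negbTE parity).
by rewrite parity.
Qed.

(** * Congruences from equalities in Z/N *)

Lemma val_Zp_int N (z : int) : (1 < N)%N ->
  nat_of_ord (z%:~R : 'Z_N) = `|(z %% N%:Z)%Z|%N.
Proof.
move=> N1; have N0 : N%:Z != 0 by lia.
have -> : z%:~R = `|(z %% N%:Z)%Z|%N%:R :> 'Z_N.
  rewrite {1}(divz_eq z N%:Z) intrD intrM -[N%:Z%:~R]pmulrn.
  rewrite pchar_Zp // mulr0 add0r.
  by rewrite -[in LHS](gez0_abs (modz_ge0 z N0)) -pmulrn.
rewrite val_Zp_nat // modn_small //.
by have := ltz_pmod z (_ : 0 < N%:Z); have := modz_ge0 z N0; lia.
Qed.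

Lemma eq_intr_Zp N (a b : int) : (1 < N)%N ->
  a%:~R = b%:~R :> 'Z_N -> (a = b %[mod N%:Z])%Z.
Proof.
move=> N1 ab; have N0 : N%:Z != 0 by lia.
rewrite -(gez0_abs (modz_ge0 a N0)) -(gez0_abs (modz_ge0 b N0)).
by rewrite -!val_Zp_int // ab.
Qed.

(** * Proportionality of the partition values *)

Theorem corollary1p2 (r m l B rho b1 b2 : nat) :
  (1 <= r)%N -> (1 <= m)%N -> prime l -> (r + 5 <= l)%N ->
  is_b_l l r m B -> is_r_l l r m rho -> (rho <= 1)%N ->
  (B <= b1)%N -> (B <= b2)%N -> (b1 = b2 %[mod 2])%N ->
  exists C : int,
    (forall n : int,
       (p_ r (p_arg l r b1 n) = C * p_ r (p_arg l r b2 n)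
          %[mod ((l ^ m)%N%:Z)])%Z) /\
    (rho = 0%N -> C = 0).
Proof.
move=> _ m1 l_prime _ [[odd_stable even_stable] _].
move=> [Om [[b0 OmE] [Om_rank _]]] rho1 Bb1 Bb2.
rewrite !modn2 => /(congr1 odd); rewrite !oddb => parity.
have l0 := prime_gt0 l_prime; have l_neq0 : l != 0%N by rewrite -lt0n.
have N1 : (1 < l ^ m)%N by rewrite -(exp1n m) ltn_exp2r // prime_gt1.
suff [c [b12 c0]] : exists c : 'Z_(l ^ m),
    P_mod (l ^ m) l r b1 = c *: (P_mod (l ^ m) l r b2) /\ (rho = 0%N -> c = 0).
  exists (c : nat)%:Z; split=> [n|/c0 -> //].
  apply: eq_intr_Zp => //; rewrite intrM -[((c : nat)%:Z)%:~R]pmulrn natr_Zp.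
  exact: (congr1 (fun f => f n) b12).
(* The index 2 (b0 + B) + 1 is past b0, where the odd modules equal Om, and past
   the bound B of the stable range. *)
have odd_rank : generated_by (Lambda_odd l r (2 * (b0 + B) + 1) m) rho.
  by rewrite OmE ?leq_addr.
case b2_odd : (odd b2) parity => b1_odd.
- have oddE b : odd b -> b = (2 * b./2 + 1)%N by lia.
  have L12 : Lambda_odd l r b1 m = Lambda_odd l r b2 m.
    by rewrite (oddE b1) // (oddE b2) //; apply: odd_stable; lia.
  have rank2 : generated_by (Lambda_odd l r b2 m) rho.
    rewrite (oddE b2) // (odd_stable _ (b0 + B)%N) //; lia.
  rewrite !Lambda_oddE // in L12 rank2.
  exact: (P_mod_proportional l0 l_neq0 L12 (generated_by_eta_mul l0 l_neq0 rank2)).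
- have evenE b : ~~ odd b -> b = (2 * b./2)%N by lia.
  have L12 : Lambda_even l r b1 m = Lambda_even l r b2 m.
    rewrite (evenE b1) ?b1_odd // (evenE b2) ?b2_odd //.
    by apply: even_stable; lia.
  have rank2 : generated_by (Lambda_even l r b2 m) rho.
    rewrite (evenE b2) ?b2_odd // (even_stable _ (b0 + B).+1) //; try lia.
    rewrite Lambda_evenE //; last by lia.
    (* The even orbit is the image under U_l of the odd orbit one step earlier;
       the factor eta(lz)^r is removed there and eta(z)^r put back here. *)
    rewrite span_image; apply: generated_by_image.
    rewrite (_ : 2 * (b0 + B).+1 = (2 * (b0 + B) + 1).+1)%N; last by lia.
    rewrite -dilate_P_mod -(orbit_image _ (T := dilate2 (l ^ m) l)) // span_image.
    apply: generated_by_image; apply: (generated_by_eta_mul l0 l_neq0).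
    by rewrite -Lambda_oddE //; lia.
  rewrite !Lambda_evenE ?b1_odd ?b2_odd // in L12 rank2.
  exact: (P_mod_proportional l0 (oner_neq0 nat) L12
    (generated_by_eta_mul l0 (oner_neq0 nat) rank2)).
Qed.
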